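(* All $\mathbb{D}$-norms on $\mathbb{B}$ are topologically equivalent: for any two $\mathbb{D}$-norms $\mathbf{N}_1,\mathbf{N}_2$ on $\mathbb{B}$, the topologies $\mathcal{T}_{\mathbf{N}_1}$ and $\mathcal{T}_{\mathbf{N}_2}$ coincide.
   Context: $\mathbb{D}=\{x+\mathbf{j}y:x,y\in\mathbb{R}\}$, $\mathbf{j}^2=1$, $\mathbf{j}\notin\mathbb{R}$, is the algebra of hyperbolic numbers. With $\mathbf{e}_1=\frac{1+\mathbf{j}}{2}$, $\mathbf{e}_2=\frac{1-\mathbf{j}}{2}$, each $z=x+\mathbf{j}y\in\mathbb{D}$ is $z=\pi_1(z)\mathbf{e}_1+\pi_2(z)\mathbf{e}_2$, where $\pi_1(z)=x+y$, $\pi_2(z)=x-y$. Order: $z\le w$ iff $\pi_k(z)\le\pi_k(w)$ for $k=1,2$; and $z\ll w$ iff $\pi_k(z)<\pi_k(w)$ for $k=1,2$. $\mathbb{B}$ is the commutative real algebra of bicomplex numbers $a+b\mathbf{i}+c\mathbf{j}+d\mathbf{k}$ ($a,b,c,d\in\mathbb{R}$), with $\mathbf{i}^2=\mathbf{k}^2=-1$, $\mathbf{j}^2=1$, $\mathbf{i}\mathbf{k}=\mathbf{k}\mathbf{i}=\mathbf{j}$. A $\mathbb{D}$-norm on $\mathbb{B}$ is a function $\mathbf{N}:\mathbb{B}\to\mathbb{D}$ such that (i) $\mathbf{N}(\omega)=0$ implies $\omega=0$; (ii) $\mathbf{N}(\lambda\omega)=|\lambda|\mathbf{N}(\omega)$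 for all $\lambda\in\mathbb{R}$, $\omega\in\mathbb{B}$; (iii) $\mathbf{N}(\omega+\psi)\le\mathbf{N}(\omega)+\mathbf{N}(\psi)$ for all $\omega,\psi\in\mathbb{B}$. For $\omega_0\in\mathbb{B}$ and $\tau\in\mathbb{D}$ with $\tau\gg0$, the open $\mathbb{D}$-ball is $\{\omega\in\mathbb{B}:\mathbf{N}(\omega-\omega_0)\ll\tau\}$. $\mathcal{T}_{\mathbf{N}}$ is the topology on $\mathbb{B}$ whose nonempty open sets are the nonempty $\mathcal{O}\subset\mathbb{B}$ such that each point of $\mathcal{O}$ is the center of some $\mathbb{D}$-ball (with radius $\tau\gg0$) contained in $\mathcal{O}$. *)

(* Defs.v *)
From HB Require Import structures.
From mathcomp Require Import all_boot all_order all_algebra.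
From mathcomp Require Import ring lra.
From mathcomp Require Import all_classical all_reals all_analysis.

Set Implicit Arguments.
Unset Strict Implicit.
Unset Printing Implicit Defensive.

Import Order.TTheory GRing.Theory Num.Theory.

Local Open Scope classical_set_scope.
Local Open Scope ring_scope.

(** * Hyperbolic numbers *)

(* [Hyp x y] stands for x + j y. *)
Record hyperbolic (R : realType) := Hyp { hre : R; him : R }.

Definition hyp_to_pair (R : realType) (z : hyperbolic R) : R * R :=
  (hre z, him z).
Definition hyp_of_pair (R : realType) (p : R * R) : hyperbolic R :=
  Hyp p.1 p.2.

Lemma hyp_to_pairK (R : realType) :
  cancel (@hyp_to_pair R) (@hyp_of_pair R).
Proof. by case. Qed.

HB.instance Definition _ (R : realType) :=
  Choice.copy (hyperbolic R) (can_type (@hyp_to_pairK R)).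

Definition hyp_zero (R : realType) : hyperbolic R := Hyp 0 0.
Definition hyp_opp (R : realType) (z : hyperbolic R) : hyperbolic R :=
  Hyp (- hre z) (- him z).
Definition hyp_add (R : realType) (z w : hyperbolic R) : hyperbolic R :=
  Hyp (hre z + hre w) (him z + him w).
Definition hyp_one (R : realType) : hyperbolic R := Hyp 1 0.
Definition hyp_mul (R : realType) (z w : hyperbolic R) : hyperbolic R :=
  Hyp (hre z * hre w + him z * him w) (hre z * him w + him z * hre w).
Definition hyp_scale (R : realType) (a : R) (z : hyperbolic R) :
  hyperbolic R := Hyp (a * hre z) (a * him z).

Lemma hyp_addA (R : realType) : associative (@hyp_add R).
Proof. by move=> [? ?] [? ?] [? ?]; congr Hyp; rewrite /= addrA. Qed.
Lemma hyp_addC (R : realType) : commutative (@hyp_add R).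
Proof. by move=> [? ?] [? ?]; congr Hyp; rewrite /= addrC. Qed.
Lemma hyp_add0 (R : realType) : left_id (@hyp_zero R) (@hyp_add R).
Proof. by move=> [? ?]; congr Hyp; rewrite /= add0r. Qed.
Lemma hyp_addN (R : realType) :
  left_inverse (@hyp_zero R) (@hyp_opp R) (@hyp_add R).
Proof. by move=> [? ?]; congr Hyp; rewrite /= addNr. Qed.

HB.instance Definition _ (R : realType) :=
  GRing.isZmodule.Build (hyperbolic R)
    (@hyp_addA R) (@hyp_addC R) (@hyp_add0 R) (@hyp_addN R).

Lemma hyp_mulA (R : realType) : associative (@hyp_mul R).
Proof. by move=> [? ?] [? ?] [? ?]; congr Hyp => /=; ring. Qed.
Lemma hyp_mulC (R : realType) : commutative (@hyp_mul R).
Proof. by move=> [? ?] [? ?]; congr Hyp => /=; ring. Qed.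
Lemma hyp_mul1 (R : realType) : left_id (@hyp_one R) (@hyp_mul R).
Proof. by move=> [? ?]; congr Hyp => /=; ring. Qed.
Lemma hyp_mulDl (R : realType) : left_distributive (@hyp_mul R) +%R.
Proof. by move=> [? ?] [? ?] [? ?]; congr Hyp => /=; ring. Qed.
Lemma hyp_one_neq0 (R : realType) : @hyp_one R != 0.
Proof. by apply/eqP => -[] /eqP; rewrite oner_eq0. Qed.

HB.instance Definition _ (R : realType) :=
  GRing.Zmodule_isComNzRing.Build (hyperbolic R)
    (@hyp_mulA R) (@hyp_mulC R) (@hyp_mul1 R) (@hyp_mulDl R)
    (@hyp_one_neq0 R).

Lemma hyp_scaleA (R : realType) (a b : R) (z : hyperbolic R) :
  hyp_scale a (hyp_scale b z) = hyp_scale (a * b) z.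
Proof. by congr Hyp; rewrite /= mulrA. Qed.
Lemma hyp_scale1 (R : realType) : left_id 1 (@hyp_scale R).
Proof. by move=> [? ?]; congr Hyp; rewrite /= mul1r. Qed.
Lemma hyp_scaleDr (R : realType) : right_distributive (@hyp_scale R) +%R.
Proof. by move=> ? [? ?] [? ?]; congr Hyp; rewrite /= mulrDr. Qed.
Lemma hyp_scaleDl (R : realType) (z : hyperbolic R) :
  {morph (@hyp_scale R)^~ z : a b / a + b}.
Proof. by move=> ? ?; congr Hyp; rewrite /= mulrDl. Qed.

HB.instance Definition _ (R : realType) :=
  GRing.Zmodule_isLmodule.Build R (hyperbolic R)
    (@hyp_scaleA R) (@hyp_scale1 R) (@hyp_scaleDr R) (@hyp_scaleDl R).

Lemma hyp_scaleAl (R : realType) (a : R) (z w : hyperbolic R) :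
  a *: (z * w) = (a *: z) * w.
Proof. by congr Hyp => /=; ring. Qed.

HB.instance Definition _ (R : realType) :=
  GRing.Lmodule_isLalgebra.Build R (hyperbolic R) (@hyp_scaleAl R).
HB.instance Definition _ (R : realType) :=
  GRing.Lalgebra_isComAlgebra.Build R (hyperbolic R).

Definition hyp_j (R : realType) : hyperbolic R := Hyp 0 1.
Definition hyp_e1 (R : realType) : hyperbolic R := 2^-1 *: (1 + hyp_j R).
Definition hyp_e2 (R : realType) : hyperbolic R := 2^-1 *: (1 - hyp_j R).
Definition pi1 (R : realType) (z : hyperbolic R) : R := hre z + him z.
Definition pi2 (R : realType) (z : hyperbolic R) : R := hre z - him z.

Lemma hyp_jj (R : realType) : hyp_j R * hyp_j R = 1.
Proof. by congr Hyp => /=; ring. Qed.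

Lemma hypE (R : realType) (z : hyperbolic R) :
  z = hre z *: 1 + him z *: hyp_j R.
Proof. by case: z => x y; congr Hyp => /=; ring. Qed.

Lemma hyp_idempE (R : realType) (z : hyperbolic R) :
  z = pi1 z *: hyp_e1 R + pi2 z *: hyp_e2 R.
Proof. by case: z => x y; rewrite /pi1 /pi2; congr Hyp => /=; field. Qed.

Definition hyp_le (R : realType) (z w : hyperbolic R) : bool :=
  (pi1 z <= pi1 w) && (pi2 z <= pi2 w).

Lemma hyp_le_refl (R : realType) : reflexive (@hyp_le R).
Proof. by move=> z; rewrite /hyp_le !lexx. Qed.
Lemma hyp_le_anti (R : realType) : antisymmetric (@hyp_le R).
Proof.
move=> [x y] [u v]; rewrite /hyp_le /pi1 /pi2 /=.
by move=> /andP[/andP[? ?] /andP[? ?]]; congr Hyp; lra.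
Qed.
Lemma hyp_le_trans (R : realType) : transitive (@hyp_le R).
Proof.
move=> w z t /andP[zw1 zw2] /andP[wt1 wt2].
by rewrite /hyp_le (le_trans zw1) // (le_trans zw2).
Qed.

HB.instance Definition _ (R : realType) :=
  Order.Le_isPOrder.Build ring_display (hyperbolic R)
    (@hyp_le_refl R) (@hyp_le_anti R) (@hyp_le_trans R).

(* Strictly stronger than the strict order [z < w] of the instance above,
   which only means z <= w and z <> w. *)
Definition hyp_ll (R : realType) (z w : hyperbolic R) : Prop :=
  pi1 z < pi1 w /\ pi2 z < pi2 w.

(** * Bicomplex numbers *)

(* [Bicomplex a b c d] stands for a + b i + c j + d k. *)
Record bicomplex (R : realType) :=
  Bicomplex { bc1 : R; bci : R; bcj : R; bck : R }.

Definition bc_to_tuple (R : realType) (w : bicomplex R) : R * R * R * R :=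
  (bc1 w, bci w, bcj w, bck w).
Definition bc_of_tuple (R : realType) (t : R * R * R * R) : bicomplex R :=
  Bicomplex t.1.1.1 t.1.1.2 t.1.2 t.2.

Lemma bc_to_tupleK (R : realType) :
  cancel (@bc_to_tuple R) (@bc_of_tuple R).
Proof. by case. Qed.

HB.instance Definition _ (R : realType) :=
  Choice.copy (bicomplex R) (can_type (@bc_to_tupleK R)).

Definition bc_zero (R : realType) : bicomplex R := Bicomplex 0 0 0 0.
Definition bc_opp (R : realType) (w : bicomplex R) : bicomplex R :=
  Bicomplex (- bc1 w) (- bci w) (- bcj w) (- bck w).
Definition bc_add (R : realType) (v w : bicomplex R) : bicomplex R :=
  Bicomplex (bc1 v + bc1 w) (bci v + bci w) (bcj v + bcj w) (bck v + bck w).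
Definition bc_one (R : realType) : bicomplex R := Bicomplex 1 0 0 0.
(* The multiplication table is i^2 = k^2 = -1, j^2 = 1, ik = ki = j, whence
   ij = ji = -k and jk = kj = -i. *)
Definition bc_mul (R : realType) (v w : bicomplex R) : bicomplex R :=
  Bicomplex
    (bc1 v * bc1 w - bci v * bci w + bcj v * bcj w - bck v * bck w)
    (bc1 v * bci w + bci v * bc1 w - bcj v * bck w - bck v * bcj w)
    (bc1 v * bcj w + bcj v * bc1 w + bci v * bck w + bck v * bci w)
    (bc1 v * bck w + bck v * bc1 w - bci v * bcj w - bcj v * bci w).
Definition bc_scale (R : realType) (a : R) (w : bicomplex R) : bicomplex R :=
  Bicomplex (a * bc1 w) (a * bci w) (a * bcj w) (a * bck w).

Lemma bc_addA (R : realType) : associative (@bc_add R).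
Proof. by move=> [????] [????] [????]; congr Bicomplex; rewrite /= addrA. Qed.
Lemma bc_addC (R : realType) : commutative (@bc_add R).
Proof. by move=> [????] [????]; congr Bicomplex; rewrite /= addrC. Qed.
Lemma bc_add0 (R : realType) : left_id (@bc_zero R) (@bc_add R).
Proof. by move=> [????]; congr Bicomplex; rewrite /= add0r. Qed.
Lemma bc_addN (R : realType) :
  left_inverse (@bc_zero R) (@bc_opp R) (@bc_add R).
Proof. by move=> [????]; congr Bicomplex; rewrite /= addNr. Qed.

HB.instance Definition _ (R : realType) :=
  GRing.isZmodule.Build (bicomplex R)
    (@bc_addA R) (@bc_addC R) (@bc_add0 R) (@bc_addN R).

Lemma bc_mulA (R : realType) : associative (@bc_mul R).
Proof. by move=> [????] [????] [????]; congr Bicomplex => /=; ring. Qed.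
Lemma bc_mulC (R : realType) : commutative (@bc_mul R).
Proof. by move=> [????] [????]; congr Bicomplex => /=; ring. Qed.
Lemma bc_mul1 (R : realType) : left_id (@bc_one R) (@bc_mul R).
Proof. by move=> [????]; congr Bicomplex => /=; ring. Qed.
Lemma bc_mulDl (R : realType) : left_distributive (@bc_mul R) +%R.
Proof. by move=> [????] [????] [????]; congr Bicomplex => /=; ring. Qed.
Lemma bc_one_neq0 (R : realType) : @bc_one R != 0.
Proof. by apply/eqP => -[] /eqP; rewrite oner_eq0. Qed.

HB.instance Definition _ (R : realType) :=
  GRing.Zmodule_isComNzRing.Build (bicomplex R)
    (@bc_mulA R) (@bc_mulC R) (@bc_mul1 R) (@bc_mulDl R) (@bc_one_neq0 R).

Lemma bc_scaleA (R : realType) (a b : R) (w : bicomplex R) :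
  bc_scale a (bc_scale b w) = bc_scale (a * b) w.
Proof. by congr Bicomplex; rewrite /= mulrA. Qed.
Lemma bc_scale1 (R : realType) : left_id 1 (@bc_scale R).
Proof. by move=> [????]; congr Bicomplex; rewrite /= mul1r. Qed.
Lemma bc_scaleDr (R : realType) : right_distributive (@bc_scale R) +%R.
Proof. by move=> ? [????] [????]; congr Bicomplex; rewrite /= mulrDr. Qed.
Lemma bc_scaleDl (R : realType) (w : bicomplex R) :
  {morph (@bc_scale R)^~ w : a b / a + b}.
Proof. by move=> ? ?; congr Bicomplex; rewrite /= mulrDl. Qed.

HB.instance Definition _ (R : realType) :=
  GRing.Zmodule_isLmodule.Build R (bicomplex R)
    (@bc_scaleA R) (@bc_scale1 R) (@bc_scaleDr R) (@bc_scaleDl R).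

Lemma bc_scaleAl (R : realType) (a : R) (v w : bicomplex R) :
  a *: (v * w) = (a *: v) * w.
Proof. by congr Bicomplex => /=; ring. Qed.

HB.instance Definition _ (R : realType) :=
  GRing.Lmodule_isLalgebra.Build R (bicomplex R) (@bc_scaleAl R).
HB.instance Definition _ (R : realType) :=
  GRing.Lalgebra_isComAlgebra.Build R (bicomplex R).

Definition bc_i (R : realType) : bicomplex R := Bicomplex 0 1 0 0.
Definition bc_j (R : realType) : bicomplex R := Bicomplex 0 0 1 0.
Definition bc_k (R : realType) : bicomplex R := Bicomplex 0 0 0 1.

Lemma bcE (R : realType) (w : bicomplex R) :
  w = bc1 w *: 1 + bci w *: bc_i R + bcj w *: bc_j R + bck w *: bc_k R.
Proof. by case: w => a b c d; congr Bicomplex => /=; ring. Qed.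

Lemma bc_ii (R : realType) : bc_i R * bc_i R = -1.
Proof. by congr Bicomplex => /=; ring. Qed.
Lemma bc_jj (R : realType) : bc_j R * bc_j R = 1.
Proof. by congr Bicomplex => /=; ring. Qed.
Lemma bc_kk (R : realType) : bc_k R * bc_k R = -1.
Proof. by congr Bicomplex => /=; ring. Qed.
Lemma bc_ik (R : realType) : bc_i R * bc_k R = bc_j R.
Proof. by congr Bicomplex => /=; ring. Qed.

(** * Hyperbolic-valued norms and their topologies *)

Record is_Dnorm (R : realType) (N : bicomplex R -> hyperbolic R) : Prop :=
  IsDnorm {
    Dnorm_eq0 : forall w, N w = 0 -> w = 0;
    DnormZ : forall (a : R) w, N (a *: w) = `|a| *: N w;
    DnormD : forall v w, N (v + w) <= N v + N w
  }.

Definition Dball (R : realType) (N : bicomplex R -> hyperbolic R)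
    (w0 : bicomplex R) (tau : hyperbolic R) : set (bicomplex R) :=
  [set w | hyp_ll (N (w - w0)) tau].

Definition Dopen (R : realType) (N : bicomplex R -> hyperbolic R)
    (O : set (bicomplex R)) : Prop :=
  forall w, O w -> exists tau, hyp_ll 0 tau /\ Dball N w tau `<=` O.

(* [Dtop N] is the type of bicomplex numbers carrying the topology of [N]. The
   axioms of a topology hold for an arbitrary function [N]. *)
Definition Dtop (R : realType) (N : bicomplex R -> hyperbolic R) : Type :=
  bicomplex R.

HB.instance Definition _ (R : realType) (N : bicomplex R -> hyperbolic R) :=
  Choice.on (Dtop N).

Lemma Dopen_setT (R : realType) (N : bicomplex R -> hyperbolic R) :
  Dopen N setT.
Proof.
by move=> w _; exists 1; split=> //; rewrite /hyp_ll /pi1 /pi2 /=; split; lra.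
Qed.

Lemma Dopen_setI (R : realType) (N : bicomplex R -> hyperbolic R) :
  setI_closed (Dopen N).
Proof.
move=> A B oA oB w [/oA [s [[s1 s2] sA]] /oB [t [[t1 t2] tB]]].
pose m1 := Num.min (pi1 s) (pi1 t); pose m2 := Num.min (pi2 s) (pi2 t).
pose m : hyperbolic R := Hyp ((m1 + m2) / 2) ((m1 - m2) / 2).
have e1 : pi1 m = m1 by rewrite /pi1 /=; field.
have e2 : pi2 m = m2 by rewrite /pi2 /=; field.
exists m; split; first by rewrite /hyp_ll e1 e2 !lt_min s1 s2 t1 t2.
move=> v; rewrite /Dball /= /hyp_ll e1 e2 !lt_min.
by move=> [/andP[? ?] /andP[? ?]]; split; [apply: sA | apply: tB].
Qed.

Lemma Dopen_bigcup (R : realType) (N : bicomplex R -> hyperbolic R)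
    (I : Type) (f : I -> set (bicomplex R)) :
  (forall i, Dopen N (f i)) -> Dopen N (\bigcup_i f i).
Proof.
move=> fo w [i _ /(fo i) [t [t0 tf]]]; exists t; split=> // v /tf fv.
by exists i.
Qed.

HB.instance Definition _ (R : realType) (N : bicomplex R -> hyperbolic R) :=
  isOpenTopological.Build (Dtop N)
    (@Dopen_setT R N) (@Dopen_setI R N) (@Dopen_bigcup R N).

Definition Dtopology (R : realType) (N : bicomplex R -> hyperbolic R) :
  set (set (bicomplex R)) := @open (Dtop N).

Lemma DtopologyE (R : realType) (N : bicomplex R -> hyperbolic R) :
  Dtopology N = Dopen N.
Proof. by []. Qed.

(* Main.v *)
(** The larger of the two idempotent components of a D-norm is an ordinary real
norm, whose balls generate the same topology as the D-balls. As bicomplex numbers form a real vector space of dimension 4,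
any two such norms are equivalent: a seminorm is bounded by a multiple of the
sup norm, and a norm attains a positive minimum on the unit sphere. *)

Require Import Defs.
From mathcomp Require Import all_boot all_order all_algebra.
From mathcomp Require Import lra.
From mathcomp Require Import all_classical all_reals all_analysis.

Set Implicit Arguments.
Unset Strict Implicit.
Unset Printing Implicit Defensive.

Import Order.TTheory GRing.Theory Num.Theory.
Import numFieldNormedType.Exports.

Local Open Scope classical_set_scope.
Local Open Scope ring_scope.

Record is_seminorm (R : realType) (V : lmodType R) (p : V -> R) : Prop :=
  IsSeminorm {
    seminormZ : forall (a : R) v, p (a *: v) = `|a| * p v;
    seminormD : forall v w, p (v + w) <= p v + p w
  }.

Section seminorm_theory.
Variables (R : realType) (V : lmodType R) (p : V -> R).
Hypothesis hp : is_seminorm p.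

Lemma seminorm0 : p 0 = 0.
Proof. by rewrite -(scale0r 0) (seminormZ hp) normr0 mul0r. Qed.

Lemma seminormN v : p (- v) = p v.
Proof. by rewrite -scaleN1r (seminormZ hp) normrN1 mul1r. Qed.

Lemma seminorm_ge0 v : 0 <= p v.
Proof.
have := seminormD hp v (- v); rewrite subrr seminorm0 seminormN; lra.
Qed.

Lemma seminorm_sum (I : Type) (r : seq I) (F : I -> V) :
  p (\sum_(i <- r) F i) <= \sum_(i <- r) p (F i).
Proof.
elim/big_ind2 : _ => [|x a y b xa yb|//]; first by rewrite seminorm0.
by rewrite (le_trans (seminormD hp _ _))// lerD.
Qed.

Lemma ler_dist_seminorm v w : `|p v - p w| <= p (v - w).
Proof.
have := seminormD hp (v - w) w; have := seminormD hp (w - v) v.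
rewrite !subrK -(opprB v w) seminormN ler_norml => *; apply/andP; split; lra.
Qed.

End seminorm_theory.

(** By the reverse triangle inequality, [p] is Lipschitz with constant [C]. *)
Lemma bounded_seminorm_continuous (R : realType) (V : normedModType R)
    (p : V -> R) (C : R) :
  is_seminorm p -> 0 < C -> (forall v, p v <= C * `|v|) -> continuous p.
Proof.
move=> hp C0 pC v; apply/cvgrPdist_lt => e e0; near=> w.
rewrite (le_lt_trans (ler_dist_seminorm hp v w))// (le_lt_trans (pC _))//.
rewrite mulrC -ltr_pdivlMr//; near: w.
by apply/nbhs_normP; exists (e / C) => //=; rewrite divr_gt0.
Unshelve. all: by end_near. Qed.

Section norms_on_row_vectors.
Variables (R : realType) (n : nat) (p : 'rV[R]_n -> R).
Hypothesis hp : is_seminorm p.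

(** Expand [v] in the standard basis: each coordinate is at most [|v|] in absolute value. *)
Lemma seminorm_le_mx_norm : exists2 C, 0 < C & forall v, p v <= C * `|v|.
Proof.
have S0 : 0 <= \sum_j p (delta_mx 0 j).
  by apply: sumr_ge0 => j _; exact: seminorm_ge0.
(* The summand 1 keeps the constant positive even when [p] vanishes on the basis. *)
exists (1 + \sum_j p (delta_mx 0 j)) => [|v]; first by rewrite ltr_pwDl.
rewrite mulrDl mul1r.
rewrite [v in p v]row_sum_delta (le_trans (seminorm_sum hp _ _))//.
apply: ler_wpDl => //; rewrite mulr_suml; apply: ler_sum => j _.
rewrite (seminormZ hp) mulrC ler_wpM2l//; first exact: seminorm_ge0.
rewrite [leRHS]/Num.Def.normr/= mx_normrE.
by apply: (le_bigmax _ (fun ij => `|v ij.1 ij.2|) (0, j)).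
Qed.

Lemma seminorm_continuous : continuous p.
Proof.
have [C C0 pC] := seminorm_le_mx_norm.
exact: (bounded_seminorm_continuous hp C0 pC).
Qed.

Hypothesis p_eq0 : forall v, p v = 0 -> v = 0.

(** The constant is the minimum of [p] on the unit sphere [S]; homogeneity carries the bound from
    [S] to all vectors. *)
Lemma mx_norm_le_norm : exists2 c, 0 < c & forall v, c * `|v| <= p v.
Proof.
pose S := [set v : 'rV[R]_n | `|v| = 1].
have S_normalized v : v != 0 -> S (`|v|^-1 *: v).
  by move=> v0; rewrite /S/= normrZ normfV normr_id mulVf// normr_eq0.
(* An empty sphere means that every vector is 0, so any positive constant works. *)
have [S0|/set0P S0] := eqVneq S set0.
  exists 1 => // v; have [->|/S_normalized] := eqVneq v 0; last by rewrite S0.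
  by rewrite normr0 mulr0 seminorm0.
have S_closed : closed S.
  by apply: (@closed_comp _ _ _ [set 1 : R]) => [v _|];
    [exact: norm_continuous | exact: closed_eq].
have S_bounded : bounded_set S.
  by exists 1; split=> // M M1 v /= ->; exact: ltW.
have [v0 + v0_min] : exists2 c, c \in S & forall v, v \in S -> p c <= p v.
  apply: EVT_min_rV => //; first exact: bounded_closed_compact.
  exact/continuous_subspaceT/seminorm_continuous.
rewrite inE => v0S.
exists (p v0) => [|v].
  (* If the minimum were 0, the minimizer would be 0, which has norm 0 and not 1. *)
  rewrite lt0r seminorm_ge0// andbT; apply/eqP => /p_eq0 v00.
  by move: v0S; rewrite /S/= v00 normr0 => /esym/eqP; rewrite oner_eq0.
have [->|vn0] := eqVneq v 0; first by rewrite normr0 mulr0 seminorm0.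
have := v0_min (`|v|^-1 *: v); rewrite inE => /(_ (S_normalized _ vn0)).
by rewrite (seminormZ hp) normfV normr_id ler_pdivlMl ?normr_gt0// mulrC.
Qed.

End norms_on_row_vectors.

Lemma norms_on_row_vectors_equiv (R : realType) (n : nat)
    (p q : 'rV[R]_n -> R) :
  is_seminorm p -> is_seminorm q -> (forall v, q v = 0 -> v = 0) ->
  exists2 C, 0 < C & forall v, p v <= C * q v.
Proof.
move=> hp hq q_eq0.
have [C C0 pC] := seminorm_le_mx_norm hp.
have [c c0 cq] := mx_norm_le_norm hq q_eq0.
exists (C / c) => [|v]; first by rewrite divr_gt0.
rewrite (le_trans (pC v))// -mulrA ler_wpM2l ?(ltW C0)//.
by rewrite ler_pdivlMl.
Qed.

(** A linear isomorphism through which norms on [bicomplex R] are pulled back to row vectors. *)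
Definition bc_of_row (R : realType) (v : 'rV[R]_4) : bicomplex R :=
  Bicomplex (v 0 0) (v 0 1) (v 0 2%:R) (v 0 3%:R).

Definition row_of_bc (R : realType) (w : bicomplex R) : 'rV[R]_4 :=
  \row_i [:: bc1 w; bci w; bcj w; bck w]`_i.

Lemma row_of_bcK (R : realType) : cancel (@row_of_bc R) (@bc_of_row R).
Proof. by case=> a b c d; rewrite /bc_of_row !mxE. Qed.

Lemma bc_of_rowK (R : realType) : cancel (@bc_of_row R) (@row_of_bc R).
Proof.
move=> v; apply/rowP => i; rewrite mxE.
by case: i => -[|[|[|[|//]]]] i4 /=; congr (v 0 _); exact: val_inj.
Qed.

Lemma bc_of_row0 (R : realType) : bc_of_row (0 : 'rV[R]_4) = 0.
Proof. by rewrite /bc_of_row !mxE. Qed.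

Lemma bc_of_rowD (R : realType) : {morph @bc_of_row R : v w / v + w}.
Proof. by move=> v w; rewrite /bc_of_row !mxE. Qed.

Lemma bc_of_rowZ (R : realType) (a : R) :
  {morph @bc_of_row R : v / a *: v}.
Proof. by move=> v; rewrite /bc_of_row !mxE. Qed.

(** For [0 <= z], this is the sup norm of [z] in idempotent coordinates. *)
Definition max_pi (R : realType) (z : hyperbolic R) : R :=
  Num.max (pi1 z) (pi2 z).

(** Both idempotent components of [t *: 1] equal [t], so balls of [max_pi \o N] are D-balls of real
    radius. *)
Lemma max_pi_lt (R : realType) (z : hyperbolic R) (t : R) :
  max_pi z < t <-> hyp_ll z (t *: 1).
Proof.
rewrite /max_pi /hyp_ll gt_max /pi1 /pi2/= mulr1 mulr0 addr0 subr0.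
by split=> [/andP|[-> ->]].
Qed.

Section real_norm_of_Dnorm.
Variables (R : realType) (N : bicomplex R -> hyperbolic R).
Hypothesis hN : is_Dnorm N.

Lemma pi1_Dnorm_seminorm : is_seminorm (@pi1 R \o N).
Proof.
split=> [a w|v w] /=; first by rewrite (DnormZ hN) /pi1/= -mulrDr.
have /andP[+ _] : hyp_le (N (v + w)) (N v + N w) := DnormD hN v w.
by rewrite /pi1/=; lra.
Qed.

Lemma pi2_Dnorm_seminorm : is_seminorm (@pi2 R \o N).
Proof.
split=> [a w|v w] /=; first by rewrite (DnormZ hN) /pi2/= -mulrBr.
have /andP[_ +] : hyp_le (N (v + w)) (N v + N w) := DnormD hN v w.
by rewrite /pi2/=; lra.
Qed.

Lemma max_pi_Dnorm_seminorm : is_seminorm (@max_pi R \o N).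
Proof.
have [Z1 D1] := pi1_Dnorm_seminorm; have [Z2 D2] := pi2_Dnorm_seminorm.
split=> [a w|v w]; rewrite /max_pi/=.
  by rewrite (Z1 a w : pi1 _ = _) (Z2 a w : pi2 _ = _) -maxr_pMr.
by rewrite ge_max (le_trans (D1 v w)) ?(le_trans (D2 v w))//=
  lerD// le_max lexx ?orbT.
Qed.

(** Each component of [N] alone may vanish off 0; but both are nonnegative, so a zero maximum kills
    both and hence [N w]. *)
Lemma max_pi_Dnorm_eq0 w : max_pi (N w) = 0 -> w = 0.
Proof.
move=> m0; apply: (Dnorm_eq0 hN).
have /= p1 := seminorm_ge0 pi1_Dnorm_seminorm w.
have /= p2 := seminorm_ge0 pi2_Dnorm_seminorm w.
have /andP[] : (pi1 (N w) <= 0) && (pi2 (N w) <= 0) by rewrite -ge_max -m0.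
move: p1 p2; rewrite /pi1 /pi2; case: (N w) => x y /= *; congr Hyp; lra.
Qed.

End real_norm_of_Dnorm.

Lemma max_pi_Dnorm_equiv (R : realType) (N1 N2 : bicomplex R -> hyperbolic R) :
  is_Dnorm N1 -> is_Dnorm N2 ->
  exists2 C, 0 < C & forall w, max_pi (N1 w) <= C * max_pi (N2 w).
Proof.
move=> hN1 hN2.
have row_seminorm N : is_Dnorm N -> is_seminorm (@max_pi R \o N \o @bc_of_row R).
  move=> /max_pi_Dnorm_seminorm[hZ hD].
  by split=> [a v|v w] /=; [rewrite bc_of_rowZ; exact: hZ
                          | rewrite bc_of_rowD; exact: hD].
have [|C C0 NC] :=
    norms_on_row_vectors_equiv (row_seminorm _ hN1) (row_seminorm _ hN2).
  move=> v /= /(max_pi_Dnorm_eq0 hN2) v0.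
  by apply: (can_inj (@bc_of_rowK R)); rewrite v0 bc_of_row0.
by exists C => // w; have := NC (row_of_bc w); rewrite /= row_of_bcK.
Qed.

Lemma Dopen_sub (R : realType) (N1 N2 : bicomplex R -> hyperbolic R) :
  is_Dnorm N1 -> is_Dnorm N2 -> Dopen N1 `<=` Dopen N2.
Proof.
move=> hN1 hN2 O O_open w /O_open[t [[t1 t2] tO]].
have [C C0 NC] := max_pi_Dnorm_equiv hN1 hN2.
(* The condition [max_pi (N1 (v - w)) < m] puts [v] in the D-ball of radius [t]; by the choice of
   [C], it follows from [max_pi (N2 (v - w)) < m / C]. *)
pose m := Num.min (pi1 t) (pi2 t).
have m0 : 0 < m.
  by move: t1 t2; rewrite {1}/pi1 {1}/pi2/= addr0 subr0 lt_min => -> ->.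
exists ((m / C) *: 1); split.
  by apply/max_pi_lt; rewrite /max_pi /pi1 /pi2/= addr0 subr0 maxxx divr_gt0.
move=> v /max_pi_lt; rewrite ltr_pdivlMr// mulrC => vm; apply: tO.
have := le_lt_trans (NC _) vm.
by rewrite /max_pi gt_max !lt_min => /andP[/andP[? _] /andP[_ ?]]; split.
Qed.

Theorem proposition3p14 (R : realType) (N1 N2 : bicomplex R -> hyperbolic R)
    (hN1 : is_Dnorm N1) (hN2 : is_Dnorm N2) :
  Dtopology N1 = Dtopology N2.
Proof. by rewrite !DtopologyE; apply/seteqP; split; exact: Dopen_sub. Qed.
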